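(* Let $k\ge4$, let $\tau=(\rho',1,k)\in\mathfrak M_k$, and let $\rho\in\mathfrak M_{k-2}$ be the permutation obtained by decreasing each entry of $\rho'$ by $1$. Then $$N_\tau(x)=\frac{1}{1-x-x^2N_\rho(x)}.$$
   Context: A permutation $\pi=\pi_1\cdots\pi_n$ is a Motzkin permutation if it avoids the pattern $132$ (no $i<j<k$ with $\pi_i<\pi_k<\pi_j$) and there are no indices $a<b$ with $\pi_a<\pi_b<\pi_{b+1}$; $\mathfrak M_n$ is the set of them. For a permutation $\sigma$, $N_\sigma(x)=\sum_{n\ge0}|\mathfrak M_n(\sigma)|x^n$, where $\mathfrak M_n(\sigma)$ is the set of Motzkin permutations of length $n$ avoiding $\sigma$ in the classical sense (no subsequence order-isomorphic to $\sigma$). $(\rho',1,k)$ denotes the sequence $\rho'$ followed by $1$ and $k$. *)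

(* Defs.v *)
From HB Require Import structures.
From mathcomp Require Import all_boot all_order all_algebra.
From mathcomp Require Import boolp.

Set Implicit Arguments.
Unset Strict Implicit.
Unset Printing Implicit Defensive.

Import GRing.Theory.

(* The ring R[[x]] of formal power series; multiplication is the Cauchy
   product, and division is the ring's own _ / _. *)

Section FPS.
Local Open Scope ring_scope.

Record fps (R : Type) := FPS { fcoef : nat -> R }.

HB.instance Definition _ (R : Type) := gen_eqMixin (fps R).
HB.instance Definition _ (R : Type) := gen_choiceMixin (fps R).

Lemma fpsP (R : Type) (f g : fps R) : fcoef f =1 fcoef g <-> f = g.
Proof.
by split=> [|-> //]; case: f g => [f] [g] /= /funext ->.
Qed.

Section Zmodule.
Variable R : zmodType.
Implicit Types f g : fps R.

Definition fps_zero : fps R := FPS (fun=> 0).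
Definition fps_opp f := FPS (fun n => - fcoef f n).
Definition fps_add f g := FPS (fun n => fcoef f n + fcoef g n).

Fact fps_addA : associative fps_add.
Proof. by move=> f g h; apply/fpsP => n /=; rewrite addrA. Qed.
Fact fps_addC : commutative fps_add.
Proof. by move=> f g; apply/fpsP => n /=; rewrite addrC. Qed.
Fact fps_add0 : left_id fps_zero fps_add.
Proof. by move=> f; apply/fpsP => n /=; rewrite add0r. Qed.
Fact fps_addN : left_inverse fps_zero fps_opp fps_add.
Proof. by move=> f; apply/fpsP => n /=; rewrite addNr. Qed.

HB.instance Definition _ := GRing.isZmodule.Build (fps R)
  fps_addA fps_addC fps_add0 fps_addN.

Lemma fcoef0 n : fcoef (0 : fps R) n = 0. Proof. by []. Qed.
Lemma fcoefD f g n : fcoef (f + g) n = fcoef f n + fcoef g n.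
Proof. by []. Qed.
Lemma fcoefN f n : fcoef (- f) n = - fcoef f n. Proof. by []. Qed.
Lemma fcoefB f g n : fcoef (f - g) n = fcoef f n - fcoef g n.
Proof. by []. Qed.

End Zmodule.

Section Ring.
Variable R : comNzRingType.
Implicit Types f g : fps R.

Definition fps_one : fps R := FPS (fun n => (n == 0)%:R).
Definition fps_mul f g :=
  FPS (fun n => \sum_(i < n.+1) fcoef f i * fcoef g (n - i)%N).

Fact fcoef_mul_rev f g n :
  fcoef (fps_mul f g) n = \sum_(i < n.+1) fcoef f (n - i)%N * fcoef g i.
Proof.
rewrite /= (reindex_inj rev_ord_inj) /=.
by apply: eq_bigr => j _; rewrite (sub_ordK j).
Qed.

Fact fps_mulC : commutative fps_mul.
Proof.
move=> f g; apply/fpsP => n; rewrite fcoef_mul_rev /=.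
by apply: eq_bigr => i _; rewrite mulrC.
Qed.

Fact fps_mulA : associative fps_mul.
Proof.
move=> f g h; apply/fpsP=> i; rewrite [RHS]fcoef_mul_rev.
pose coef3 j k := fcoef f j * (fcoef g (i - j - k)%N * fcoef h k).
transitivity (\sum_(j < i.+1) \sum_(k < i.+1 | (k <= i - j)%N) coef3 j k).
  apply: eq_bigr => /= j _.
  rewrite -[X in _ * X]/(fcoef (fps_mul g h) (i - j)) fcoef_mul_rev big_distrr /=.
  by rewrite (big_ord_narrow_leq (leq_subr _ _)).
rewrite (exchange_big_dep predT) //=; apply: eq_bigr => k _.
transitivity (\sum_(j < i.+1 | (j <= i - k)%N) coef3 j k).
  apply: eq_bigl => j; rewrite -ltnS -(ltnS j) -!subSn ?leq_ord //.
  by rewrite -subn_gt0 -(subn_gt0 j) -!subnDA addnC.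
rewrite (big_ord_narrow_leq (leq_subr _ _)) big_distrl /=.
by apply: eq_bigr => j _; rewrite /coef3 -!subnDA addnC mulrA.
Qed.

Fact fps_mul1 : left_id fps_one fps_mul.
Proof.
move=> f; apply/fpsP => n /=; rewrite big_ord_recl /= mul1r subn0.
by rewrite big1 ?addr0 // => j _; rewrite mul0r.
Qed.

Fact fps_mulDl : left_distributive fps_mul +%R.
Proof.
move=> f g h; apply/fpsP => n /=; rewrite -big_split.
by apply: eq_bigr => j _; rewrite mulrDl.
Qed.

Fact fps_one_neq0 : fps_one != 0.
Proof. by apply/eqP => /fpsP/(_ 0) /= /eqP; rewrite oner_eq0. Qed.

HB.instance Definition _ := GRing.Zmodule_isComNzRing.Build (fps R)
  fps_mulA fps_mulC fps_mul1 fps_mulDl fps_one_neq0.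

Lemma fcoef1 n : fcoef (1 : fps R) n = (n == 0)%:R. Proof. by []. Qed.
Lemma fcoefM f g n :
  fcoef (f * g) n = \sum_(i < n.+1) fcoef f i * fcoef g (n - i)%N.
Proof. by []. Qed.

Definition fpsX : fps R := FPS (fun n => (n == 1)%:R).

End Ring.

Section UnitRing.
Variable R : comUnitRingType.
Implicit Types f g : fps R.

(* The first n coefficients of the inverse of f. *)
Fixpoint fps_inv_seq f n : seq R :=
  if n is m.+1 then
    let s := fps_inv_seq f m in
    rcons s ((fcoef f 0)^-1 *
             ((m == 0)%:R - \sum_(i < m) s`_i * fcoef f (m - i)%N))
  else [::].

Definition fps_unit : {pred fps R} := fun f => fcoef f 0 \is a GRing.unit.

(* As for every unitRingType, a non-unit is its own junk inverse. *)
Definition fps_inv f : fps R :=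
  if f \in fps_unit then FPS (fun n => (fps_inv_seq f n.+1)`_n) else f.

Fact size_fps_inv_seq f n : size (fps_inv_seq f n) = n.
Proof. by elim: n => //= n IHn; rewrite size_rcons IHn. Qed.

Fact nth_fps_inv_seq f n i :
  (i < n)%N -> (fps_inv_seq f n)`_i = (fps_inv_seq f i.+1)`_i.
Proof.
elim: n => // n IHn; rewrite ltnS leq_eqVlt => /predU1P[-> //|lt_in].
by rewrite [fps_inv_seq f n.+1]/= nth_rcons size_fps_inv_seq lt_in IHn.
Qed.

Fact fps_mulV : {in fps_unit, left_inverse 1 fps_inv *%R}.
Proof.
move=> f Uf; apply/fpsP => n; rewrite fcoefM fcoef1 /fps_inv Uf.
rewrite big_ord_recr /= subnn nth_rcons size_fps_inv_seq ltnn eqxx.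
rewrite mulrC mulVKr //.
under eq_bigr => i _ do rewrite -[rcons _ _]/(fps_inv_seq f i.+1)
  -(nth_fps_inv_seq f (ltn_ord i)).
by rewrite addrC subrK.
Qed.

Fact fps_unitPl f g : g * f = 1 -> fps_unit f.
Proof.
move/fpsP/(_ 0); rewrite fcoefM big_ord1 subn0 fcoef1 => gf1.
by apply/unitrPr; exists (fcoef g 0); rewrite mulrC.
Qed.

Fact fps_inv_out : {in [predC fps_unit], fps_inv =1 id}.
Proof. by move=> f nUf; rewrite /fps_inv ifN. Qed.

HB.instance Definition _ := GRing.ComNzRing_hasMulInverse.Build (fps R)
  fps_mulV fps_unitPl fps_inv_out.

Lemma fps_unitE f : (f \is a GRing.unit) = (fcoef f 0 \is a GRing.unit).
Proof. by []. Qed.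

End UnitRing.
End FPS.

(* A permutation of length n is written in one-line notation, as a word on the
   letters 1, ..., n; positions in words are numbered from 0. *)

Definition order_isomorphic (s t : seq nat) : bool :=
  (size s == size t) &&
  [forall i : 'I_(size s), forall j : 'I_(size s),
     (nth 0 s i < nth 0 s j) == (nth 0 t i < nth 0 t j)].

(* The subsequences of s are the words mask m s. *)
Definition avoids (sigma s : seq nat) : bool :=
  ~~ [exists m : (size s).-tuple bool, order_isomorphic (mask m s) sigma].

Definition has_vincular_1_23 (s : seq nat) : bool :=
  [exists a : 'I_(size s), exists b : 'I_(size s),
    [&& a < b, b.+1 < size s & nth 0 s a < nth 0 s b < nth 0 s b.+1]].

(* permutations is duplicate-free, so sizes of filters of Motzkin n are
   cardinalities. *)
Definition Motzkin (n : nat) : seq (seq nat) :=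
  [seq s <- permutations (iota 1 n) |
     avoids [:: 1; 3; 2] s && ~~ has_vincular_1_23 s].

Definition Motzkin_avoiding (sigma : seq nat) (n : nat) : seq (seq nat) :=
  [seq s <- Motzkin n | avoids sigma s].

Definition N (sigma : seq nat) : fps int :=
  FPS (fun n => (size (Motzkin_avoiding sigma n))%:Z%R).

(* So the division in 1 / (1 - x - x^2 N_rho) is a genuine one. *)
Lemma denominator_unit (sigma : seq nat) :
  ((1 - fpsX int - fpsX int ^+ 2 * N sigma) \is a GRing.unit)%R.
Proof.
by rewrite fps_unitE !fcoefB fcoefM big_ord1 (fcoefM (fpsX int) (fpsX int))
  big_ord1.
Qed.

(* Main.v *)
(** Let [n] be the largest letter of a nonempty Motzkin permutation.  Avoiding
    132 makes every letter before [n] exceed every letter after it, and the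
    vincular condition makes the letter just before [n], if any, the smallest
    of those before [n].  So the permutation is either [n :: s] or
    [p ++ [:: m; n] ++ s] with [p > m > s], where [p] and [s] are arbitrary
    Motzkin words.  The first letter of [tau = (rho', 1, k)] is smaller than
    its last one, so no occurrence of [tau] straddles a cut between larger
    letters and smaller ones; and [p ++ [:: m; n]] avoids [tau] iff [p] avoids
    [rho].  Counting gives [N tau = 1 + x * N tau + x ^ 2 * N rho * N tau]. *)
Require Import Defs.
From mathcomp Require Import all_boot all_order all_algebra.
From mathcomp Require Import zify ring.

(** * Order isomorphism, subsequences and classical avoidance *)

Lemma order_isomorphicP s t :
  reflect (size s = size t /\
           forall i j, i < size s -> j < size s ->
             (nth 0 s i < nth 0 s j) = (nth 0 t i < nth 0 t j))
          (order_isomorphic s t).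
Proof.
apply: (iffP andP) => [[/eqP -> /forallP H]|[-> H]]; split=> //.
  move=> i j lti ltj.
  by have /forallP/(_ (Ordinal ltj))/eqP := H (Ordinal lti).
by apply/forallP => i; apply/forallP => j; apply/eqP/H.
Qed.

Lemma order_isomorphic_map (f : nat -> nat) s t :
  {mono f : x y / x < y} ->
  (order_isomorphic (map f s) t = order_isomorphic s t) *
  (order_isomorphic s (map f t) = order_isomorphic s t).
Proof.
move=> fM.
have cmp u i j : i < size u -> j < size u ->
    (nth 0 (map f u) i < nth 0 (map f u) j) = (nth 0 u i < nth 0 u j).
  by move=> lti ltj; rewrite !(nth_map 0) ?fM.
split; apply/order_isomorphicP/order_isomorphicP;
  rewrite ?size_map => -[st H]; split=> // i j lti ltj.
- by rewrite -H ?cmp.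
- by rewrite cmp // H.
- by rewrite H // cmp // -st.
- by rewrite H // cmp // -st.
Qed.

Lemma order_isomorphic_rcons_inv s t a b :
  order_isomorphic (rcons s a) (rcons t b) -> order_isomorphic s t.
Proof.
case/order_isomorphicP; rewrite !size_rcons => -[st] H.
apply/order_isomorphicP; split=> // i j lti ltj.
have := H i j (ltnW lti) (ltnW ltj).
by rewrite !nth_rcons -st lti ltj.
Qed.

Lemma order_isomorphic_rcons s t a b :
  (forall x y, x \in s -> y \in t -> (x < a) = (y < b) /\ (a < x) = (b < y)) ->
  order_isomorphic s t -> order_isomorphic (rcons s a) (rcons t b).
Proof.
move=> ab /order_isomorphicP[st H]; apply/order_isomorphicP.
rewrite !size_rcons st; split=> // i j; rewrite !ltnS !nth_rcons st.
case: (ltngtP i (size t)) => // lti _; case: (ltngtP j (size t)) => // ltj _.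
- by apply: H; rewrite st.
- by have [] := ab (nth 0 s i) (nth 0 t i); rewrite ?mem_nth ?st.
- by have [] := ab (nth 0 s j) (nth 0 t j); rewrite ?mem_nth ?st.
- by rewrite !ltnn.
Qed.

Lemma avoidsPn sigma s :
  reflect (exists2 t, subseq t s & order_isomorphic t sigma)
          (~~ avoids sigma s).
Proof.
rewrite negbK; apply: (iffP existsP) => [[m iso_m]|[t /subseqP[m sz_m ->] iso]].
  by exists (mask m s); rewrite ?mask_subseq.
by exists (tcast sz_m (in_tuple m)); rewrite val_tcast.
Qed.

Lemma subseq_catP {T : eqType} (t s1 s2 : seq T) :
  reflect (exists t1 t2, [/\ t = t1 ++ t2, subseq t1 s1 & subseq t2 s2])
          (subseq t (s1 ++ s2)).
Proof.
apply: (iffP idP) => [/subseqP[m sz_m ->]|[t1 [t2 [-> ? ?]]]]; last first.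
  exact: cat_subseq.
exists (mask (take (size s1) m) s1), (mask (drop (size s1) m) s2).
rewrite !mask_subseq -mask_cat ?cat_take_drop // size_takel //.
by rewrite sz_m size_cat leq_addr.
Qed.

Lemma subseq_rcons_inv {T : eqType} (t s : seq T) a b :
  subseq (rcons t a) (rcons s b) ->
  subseq (rcons t a) s \/ a = b /\ subseq t s.
Proof.
rewrite -subseq_rev !rev_rcons /=; case: eqP => [->|_].
  by rewrite subseq_rev; right.
by rewrite -rev_rcons subseq_rev; left.
Qed.

Lemma subseq_rcons2 {T : eqType} (t s : seq T) a b :
  subseq (rcons t a) (rcons s b) -> subseq t s.
Proof.
by case/subseq_rcons_inv=> [|[]//]; apply: subseq_trans; apply: subseq_rcons.
Qed.

Lemma avoids_small sigma s : size s < size sigma -> avoids sigma s.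
Proof.
apply: contraLR => /avoidsPn[t /size_subseq le_ts /andP[/eqP <- _]].
by rewrite -leqNgt.
Qed.

Lemma avoids_map (f : nat -> nat) sigma s : {mono f : x y / x < y} ->
  avoids sigma (map f s) = avoids sigma s.
Proof.
move=> fM; apply: negb_inj; apply/avoidsPn/avoidsPn => -[t sub_t iso].
  case/subseqP: sub_t => m sz_m def_t.
  exists (mask m s); first exact: mask_subseq.
  by rewrite -(order_isomorphic_map _ _ _ fM) map_mask -def_t.
by exists (map f t); [apply: map_subseq | rewrite (order_isomorphic_map _ _ _ fM)].
Qed.

(* A pattern whose first letter is below its last one cannot be cut into two
   parts with every letter of the first above every letter of the second. *)
Lemma avoids_skew x y (u s1 s2 : seq nat) :
  x < y -> (forall a b, a \in s1 -> b \in s2 -> b < a) ->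
  avoids (x :: rcons u y) (s1 ++ s2) =
  avoids (x :: rcons u y) s1 && avoids (x :: rcons u y) s2.
Proof.
move=> lt_xy gt12; apply: negb_inj; rewrite negb_and.
apply/avoidsPn/orP => [[t /subseq_catP[t1 [t2 [-> sub1 sub2]]] iso]|].
  case: t1 => [|a t1] in sub1 iso *.
    by right; apply/avoidsPn; exists t2.
  elim/last_ind: t2 => [|t2 b _] in sub2 iso *.
    by rewrite cats0 in iso; left; apply/avoidsPn; exists (a :: t1).
  have lt_ba : b < a.
    apply: gt12; first by apply: (mem_subseq sub1); rewrite mem_head.
    by apply: (mem_subseq sub2); rewrite mem_rcons mem_head.
  have {}iso : order_isomorphic (rcons (a :: t1 ++ t2) b) (rcons (x :: u) y).
    by rewrite /= rcons_cat.
  case/order_isomorphicP: iso; rewrite !size_rcons => -[sz] /(_ 0 (size (a :: t1 ++ t2)) isT (leqnn _)).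
  rewrite !nth_rcons /= sz !ltnn !eqxx lt_xy => lt_ab.
  by move: lt_ba; rewrite ltnNge ltnW.
case=> /avoidsPn[t sub_t iso]; exists t => //.
  exact: subseq_trans sub_t (prefix_subseq _ _).
exact: subseq_trans sub_t (suffix_subseq _ _).
Qed.

(** The bounds on [rho] put 1 below and [k] above every letter of [map S rho], exactly as [m] and
    [n] lie relative to [p]. So an occurrence of [rho] in [p] extends by [m] and [n], and conversely
    an occurrence of the long pattern loses its last two letters. *)
Lemma avoids_tail k (rho p : seq nat) m n :
  1 < k -> all (fun i => 0 < i < k.-1) rho -> {in p, forall x, m < x < n} -> m < n ->
  avoids (map S rho ++ [:: 1; k]) (p ++ [:: m; n]) = avoids rho p.
Proof.
move=> gt1k rhoP pP lt_mn.
have rcons2 (s : seq nat) a b : s ++ [:: a; b] = rcons (rcons s a) b.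
  by rewrite -!cats1 -catA.
have SM : {mono S : x y / x < y} by [].
rewrite !rcons2; apply: negb_inj.
apply/avoidsPn/avoidsPn => -[t sub_t iso]; last first.
  exists (rcons (rcons t m) n); first by rewrite -!cats1 !cat_subseq.
  have tP x : x \in t -> m < x < n by move/(mem_subseq sub_t)/pP.
  apply: order_isomorphic_rcons => [x y|].
    rewrite !mem_rcons !inE => xP yP.
    have ltxn : x < n by case/predU1P: xP => [->|/tP/andP[]].
    have ltyk : y < k.
      by case/predU1P: yP => [->|/mapP[z /(allP rhoP) + ->]] //; lia.
    by lia.
  apply: order_isomorphic_rcons => [x y /tP /andP[ltx _]|].
    case/mapP => z /(allP rhoP) /andP[ltz _] ->.
    by lia.
  by rewrite (order_isomorphic_map _ _ _ SM).
move: sub_t iso; elim/last_ind: t => [|t b _].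
  by move=> _ /andP[/eqP]; rewrite !size_rcons.
elim/last_ind: t => [|t a _].
  by move=> _ /andP[/eqP]; rewrite !size_rcons.
(* The occurrence need not use [m] or [n]: without its last two letters it embeds in [p] in any
   case. *)
move=> /subseq_rcons2/subseq_rcons2 sub_t.
move=> /order_isomorphic_rcons_inv/order_isomorphic_rcons_inv iso.
by exists t => //; rewrite -(order_isomorphic_map _ _ _ SM).2.
Qed.

(** * The 132 and vincular conditions on arbitrary words *)

Lemma avoids132P s :
  reflect (forall a b c, subseq [:: a; b; c] s -> ~ a < c < b)
          (avoids [:: 1; 3; 2] s).
Proof.
apply: (iffP idP) => [av a b c sub_s lt_acb|H].
  suff /negP : ~~ avoids [:: 1; 3; 2] s by [].
  apply/avoidsPn; exists [:: a; b; c] => //.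
  apply/order_isomorphicP; split=> //.
  by move=> [|[|[|i]]] [|[|[|j]]] //= _ _; lia.
apply: contraT => /avoidsPn[t sub_t /order_isomorphicP[]].
case: t sub_t => [|a [|b [|c [|]]]] // /H {}H _ cmp; case: H.
by rewrite (cmp 0 2) // (cmp 2 1).
Qed.

(** An occurrence of 132 that is new in [rcons s z] ends in [z], which plays the 2; the hypothesis
    forbids this. *)
Lemma avoids132_rcons (s : seq nat) z :
  (forall a b, a \in s -> b \in s -> a < b -> ~ a < z < b) ->
  avoids [:: 1; 3; 2] (rcons s z) = avoids [:: 1; 3; 2] s.
Proof.
move=> zP; apply/avoids132P/avoids132P => H a b c sub_s.
  by apply: H; apply: subseq_trans sub_s (subseq_rcons _ _).
case/(@subseq_rcons_inv _ [:: a; b]): sub_s => [/H//|[-> sub_s]] lt_azb.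
apply: (zP a b) => //; try by apply: (mem_subseq sub_s); rewrite !inE eqxx ?orbT.
by lia.
Qed.

Lemma vincularP s :
  reflect (forall i j, i < j -> j.+1 < size s ->
             ~ nth 0 s i < nth 0 s j < nth 0 s j.+1)
          (~~ has_vincular_1_23 s).
Proof.
apply: (iffP idP) => [/existsPn nv i j lt_ij lt_js bad|H].
  have lt_j := ltnW lt_js; have lt_i := ltn_trans lt_ij lt_j.
  have /existsPn/(_ (Ordinal lt_j)) := nv (Ordinal lt_i).
  by rewrite /= lt_ij lt_js bad.
apply/negP => /existsP[i /existsP[j /and3P[lt_ij lt_js bad]]].
exact: H lt_ij lt_js bad.
Qed.

(** An adjacent ascent cannot cross the cut, and no letter of [s1] is below a letter of [s2], so the
    three letters of an occurrence lie on the same side. *)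
Lemma vincular_skew (s1 s2 : seq nat) :
  (forall a b, a \in s1 -> b \in s2 -> b < a) ->
  ~~ has_vincular_1_23 (s1 ++ s2) =
  ~~ has_vincular_1_23 s1 && ~~ has_vincular_1_23 s2.
Proof.
move=> gt12.
have gtn i j : i < size s1 -> j < size s2 -> nth 0 s2 j < nth 0 s1 i.
  by move=> lti ltj; apply: gt12; rewrite mem_nth.
apply/vincularP/andP => [H|[/vincularP H1 /vincularP H2] i j lt_ij].
  split; apply/vincularP => i j lt_ij lt_js.
    have := H i j lt_ij; rewrite !nth_cat size_cat lt_js (ltnW lt_js).
    by rewrite (ltn_trans lt_ij (ltnW lt_js)); apply; lia.
  have := H (size s1 + i) (size s1 + j); rewrite !nth_cat size_cat.
  have ltF l : (size s1 + l < size s1) = false by lia.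
  by rewrite !ltF -[(_ + j).+1]addnS ltF !addKn; apply; lia.
rewrite size_cat !nth_cat => lt_js.
case: (ltnP j.+1 (size s1)) => [lt_j1|le_1j].
  have lt_j := ltnW lt_j1; rewrite lt_j (ltn_trans lt_ij lt_j).
  exact: H1.
(* Here [j] is the last position of [s1], so the step across the cut is a descent. *)
case: (ltnP j (size s1)) => [lt_j1|le_1j'].
  have := gtn j (j.+1 - size s1) lt_j1; case: ifP => _; lia.
case: (ltnP i (size s1)) => [lt_i1|le_1i].
  have := gtn i (j - size s1) lt_i1; lia.
have := H2 (i - size s1) (j - size s1); rewrite subSn //; apply; lia.
Qed.

(** Appending [z] creates at most one new adjacent pair, made of the last letter of [s] and [z]. *)
Lemma vincular_rcons (s : seq nat) z :
  (forall i, i.+1 < size s -> ~ nth 0 s i < last 0 s < z) ->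
  ~~ has_vincular_1_23 (rcons s z) = ~~ has_vincular_1_23 s.
Proof.
move=> zP; apply/vincularP/vincularP => H i j lt_ij.
  move=> lt_js; have := H i j lt_ij; rewrite !nth_rcons size_rcons lt_js.
  by rewrite (ltnW lt_js) (ltn_trans lt_ij (ltnW lt_js)); apply; lia.
rewrite size_rcons ltnS !nth_rcons => lt_js.
rewrite lt_js (ltn_trans lt_ij lt_js).
move: (lt_js); rewrite leq_eqVlt => /predU1P[def_s|lt_j1s].
  rewrite def_s ltnn eqxx; have := zP i.
  by rewrite -nth_last -def_s; apply.
by rewrite lt_j1s; apply: H.
Qed.

(** The letters of [s] are unconstrained, so that the predicate also applies to factors of a
    permutation. *)
Definition motzkin_avoids (sigma s : seq nat) : bool :=
  [&& avoids [:: 1; 3; 2] s, ~~ has_vincular_1_23 s & avoids sigma s].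

Lemma mem_Motzkin_avoiding sigma n s :
  (s \in Motzkin_avoiding sigma n) =
  perm_eq s (iota 1 n) && motzkin_avoids sigma s.
Proof.
rewrite !mem_filter mem_permutations /motzkin_avoids.
by rewrite andbC -!andbA [RHS]andbC -!andbA; congr (_ && (_ && _)); rewrite andbC.
Qed.

Lemma uniq_Motzkin_avoiding sigma n : uniq (Motzkin_avoiding sigma n).
Proof. by rewrite !filter_uniq ?permutations_uniq. Qed.

Lemma motzkin_avoids_small sigma s :
  size s < 2 -> size s < size sigma -> motzkin_avoids sigma s.
Proof.
move=> lt2 lts; apply/and3P; split; [exact/avoids_small/ltnW | | exact: avoids_small].
by apply/vincularP => i j; lia.
Qed.

Lemma motzkin_avoids_shift sigma c s :
  motzkin_avoids sigma (map (addn c) s) = motzkin_avoids sigma s.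
Proof.
have cM : {mono addn c : x y / x < y} by move=> x y; rewrite ltn_add2l.
rewrite /motzkin_avoids !avoids_map //; congr (_ && (_ && _)).
have cmp i j : i < j -> j.+1 < size s ->
    nth 0 (map (addn c) s) i < nth 0 (map (addn c) s) j
      < nth 0 (map (addn c) s) j.+1
    = (nth 0 s i < nth 0 s j < nth 0 s j.+1).
  by move=> ltij ltj; rewrite !(nth_map 0) ?cM //; lia.
apply/vincularP/vincularP => H i j ltij ltj.
  by rewrite -cmp //; apply: H; rewrite ?size_map.
by rewrite size_map in ltj; rewrite cmp //; apply: H.
Qed.

Lemma motzkin_avoids_skew x y (u s1 s2 : seq nat) :
  x < y -> (forall a b, a \in s1 -> b \in s2 -> b < a) ->
  motzkin_avoids (x :: rcons u y) (s1 ++ s2) =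
  motzkin_avoids (x :: rcons u y) s1 && motzkin_avoids (x :: rcons u y) s2.
Proof.
move=> lt_xy gt12; rewrite /motzkin_avoids vincular_skew //.
(* The pattern 132 itself begins below its last letter, so it splits at the cut just as the given
   pattern does. *)
rewrite (@avoids_skew 1 2 [:: 3]) // avoids_skew //.
by do 4![case: avoids => /=]; do 2![case: has_vincular_1_23 => //=].
Qed.

(** Being smaller than all of [p], [m] cannot play the 2 of 132 nor end an ascent; [n] is too large
    to play the 2, and the ascent from [m] to [n] has no smaller letter before it. *)
Lemma motzkin_avoids_tail k (rho p : seq nat) m n :
  1 < k -> all (fun i => 0 < i < k.-1) rho -> {in p, forall x, m < x < n} ->
  m < n ->
  motzkin_avoids (map S rho ++ [:: 1; k]) (p ++ [:: m; n]) =
  motzkin_avoids rho p.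
Proof.
move=> gt1k rhoP pP lt_mn; rewrite /motzkin_avoids avoids_tail //.
have -> : p ++ [:: m; n] = rcons (rcons p m) n by rewrite -!cats1 -catA.
have le_mp i : i < size p -> m < nth 0 p i by move=> /(mem_nth 0)/pP/andP[].
rewrite !avoids132_rcons ?vincular_rcons //.
- by move=> i lti; have := le_mp i (ltnW lti); lia.
- move=> i; rewrite size_rcons ltnS last_rcons nth_rcons => lti.
  by rewrite lti; have := le_mp i lti; lia.
- by move=> a b /pP/andP[]; lia.
move=> a b _; rewrite mem_rcons inE => /predU1P[->|/pP/andP[_]]; lia.
Qed.

(** * Intervals of values, and counting by the values of a statistic *)

Lemma perm_iota_cut c n (s1 s2 : seq nat) :
  (forall a b, a \in s1 -> b \in s2 -> b < a) ->
  perm_eq (s1 ++ s2) (iota c n) ->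
  perm_eq s2 (iota c (size s2)) /\
  perm_eq s1 (iota (c + size s2) (size s1)).
Proof.
move=> gt12 perm_s.
have def_n : n = size s2 + size s1.
  by rewrite -(size_iota c n) -(perm_size perm_s) size_cat addnC.
(* Sorting each part and placing the smaller one first gives a sorted rearrangement of [iota c n],
   hence [iota c n] itself; the lengths then locate the cut. *)
have sorted_s : sorted leq (sort leq s2 ++ sort leq s1).
  rewrite (sorted_pairwise leq_trans) pairwise_cat.
  rewrite -!(sorted_pairwise leq_trans) !sort_sorted //=; try exact: leq_total.
  rewrite andbT; apply/allrelP => b a.
  by rewrite !mem_sort => s2b s1a; apply/ltnW/gt12.
have : sort leq s2 ++ sort leq s1 = iota c n.
  apply: (sorted_eq leq_trans anti_leq) => //; first exact: iota_sorted.
  apply: perm_trans perm_s; rewrite perm_sym perm_catC.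
  by rewrite perm_cat ?[X in perm_eq X _]perm_sym ?perm_sort // perm_sym perm_sort.
rewrite def_n iotaD => /eqP; rewrite eqseq_cat ?size_sort ?size_iota //.
case/andP => /eqP <- /eqP <-.
by rewrite ![perm_eq _ (sort _ _)]perm_sym !perm_sort.
Qed.

Lemma size_partition {T : eqType} (f : T -> nat) N (s : seq T) :
  {in s, forall x, f x < N} ->
  size s = \sum_(i < N) size [seq x <- s | f x == i].
Proof.
under eq_bigr => i _ do rewrite size_filter.
elim: s => [|x s IHs] ltN /=; first by rewrite big1.
rewrite IHs => [|y ys]; last by rewrite ltN // inE ys orbT.
rewrite big_split /= -[LHS]add1n; congr (_ + _).
rewrite (bigD1 (Ordinal (ltN x (mem_head x s)))) //= eqxx big1 ?addn0 //.
by move=> i; rewrite -val_eqE eq_sym /= => /negbTE ->.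
Qed.

Lemma size_Motzkin_avoiding0 sigma :
  0 < size sigma -> size (Motzkin_avoiding sigma 0) = 1.
Proof.
move=> sigma_gt0; apply: (@perm_size _ _ [:: [::]]); apply: uniq_perm => // [|s].
  exact: uniq_Motzkin_avoiding.
rewrite mem_Motzkin_avoiding inE; apply/andP/eqP => [[/perm_size/size0nil]|->] //.
by rewrite motzkin_avoids_small.
Qed.

(** * The recurrence obtained from the position of the largest letter *)

Section Recurrence.

Variables (k : nat) (rho : seq nat).
Hypothesis gt1k : 1 < k.
Hypothesis rhoP : all (fun i => 0 < i < k.-1) rho.
Hypothesis rho_neq0 : 0 < size rho.

Let tau := map S rho ++ [:: 1; k].

(** The first letter of [tau] is the successor of a letter of [rho] below [k.-1], hence smaller than
    the last letter [k]. *)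
Lemma tail_pattern_skew (s1 s2 : seq nat) :
  (forall a b, a \in s1 -> b \in s2 -> b < a) ->
  motzkin_avoids tau (s1 ++ s2) =
  motzkin_avoids tau s1 && motzkin_avoids tau s2.
Proof.
rewrite /tau; case: rho rhoP rho_neq0 => //= x u /andP[xk _] _.
have -> : map S u ++ [:: 1; k] = rcons (rcons (map S u) 1) k.
  by rewrite -!cats1 -catA.
by apply: motzkin_avoids_skew; lia.
Qed.

(** A leading maximum is cut off as a one-letter skew part, which satisfies all the conditions, so
    [cons n.+1] is a bijection. *)
Lemma size_Motzkin_max_first n :
  size [seq s <- Motzkin_avoiding tau n.+1 | index n.+1 s == 0] =
  size (Motzkin_avoiding tau n).
Proof.
rewrite -(size_map (cons n.+1)); apply/perm_size/uniq_perm.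
- by rewrite filter_uniq ?uniq_Motzkin_avoiding.
- by rewrite map_inj_uniq ?uniq_Motzkin_avoiding // => ? ? [].
have perm_iota_cons s : perm_eq (n.+1 :: s) (iota 1 n.+1) = perm_eq s (iota 1 n).
  have -> : iota 1 n.+1 = rcons (iota 1 n) n.+1 by rewrite -cats1 -[in LHS](addn1 n) iotaD.
  by rewrite perm_sym perm_rcons perm_cons perm_sym.
have avoids_cons s : perm_eq s (iota 1 n) ->
    motzkin_avoids tau (n.+1 :: s) = motzkin_avoids tau s.
  move=> perm_s; rewrite -cat1s tail_pattern_skew.
    by rewrite motzkin_avoids_small // /tau size_cat addn2.
  by move=> a b; rewrite inE (perm_mem perm_s) mem_iota => /eqP->; lia.
move=> s; rewrite mem_filter mem_Motzkin_avoiding.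
apply/and3P/mapP => [[]|[{}s + ->]].
  case: s => [|x s] //=; case: (x =P n.+1) => // -> _.
  rewrite perm_iota_cons => perm_s; rewrite avoids_cons // => av_s.
  by exists s; rewrite // mem_Motzkin_avoiding perm_s.
rewrite mem_Motzkin_avoiding => /andP[perm_s av_s].
by rewrite /= eqxx perm_iota_cons avoids_cons.
Qed.

(** For [p] on the letters 1 to [i] and [s] on 1 to [j], the shifted [p] occupies the values from
    [j.+2] to [(i + j).+1], between the two letters placed after it. *)
Let join j i (p s : seq nat) :=
  (map (addn j.+1) p ++ [:: j.+1; (i + j).+2]) ++ s.

Lemma motzkin_avoids_join i j (p s : seq nat) :
  perm_eq p (iota 1 i) -> perm_eq s (iota 1 j) ->
  motzkin_avoids tau (join j i p s) =
  motzkin_avoids rho p && motzkin_avoids tau s.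
Proof.
move=> perm_p perm_s.
have pP x : x \in map (addn j.+1) p -> j.+1 < x < (i + j).+2.
  by case/mapP=> y; rewrite (perm_mem perm_p) mem_iota => + ->; lia.
rewrite tail_pattern_skew => [|a b].
  rewrite motzkin_avoids_tail ?motzkin_avoids_shift //; lia.
rewrite mem_cat !inE (perm_mem perm_s) mem_iota.
by case/or3P=> [/pP|/eqP->|/eqP->]; lia.
Qed.

Lemma perm_join i j (p s : seq nat) :
  perm_eq p (iota 1 i) -> perm_eq s (iota 1 j) ->
  perm_eq (join j i p s) (iota 1 (i + j).+2).
Proof.
move=> perm_p perm_s.
have -> : iota 1 (i + j).+2 =
    iota 1 j ++ j.+1 :: iota j.+2 i ++ [:: (i + j).+2].
  have -> : (i + j).+2 = j + (1 + (i + 1)) by lia.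
  by rewrite !iotaD /=; congr (_ ++ _ :: _ ++ [:: _]); [congr iota|]; lia.
have {}perm_p : perm_eq (map (addn j.+1) p) (iota j.+2 i).
  rewrite (_ : iota j.+2 i = map (addn j.+1) (iota 1 i)) ?perm_map //.
  by rewrite -iotaDl addn1.
apply/permP => P; have /permP/(_ P) := perm_p; have /permP/(_ P) := perm_s.
by rewrite !count_cat /= count_cat /=; lia.
Qed.

(** This inverts [join]: the two Motzkin conditions force the order of the pieces by value, and
    their lengths then determine which interval of values each one fills. *)
Lemma Motzkin_avoiding_split i j s :
  s \in Motzkin_avoiding tau (i + j).+2 -> index (i + j).+2 s = i.+1 ->
  exists p t, [/\ perm_eq p (iota 1 i), perm_eq t (iota 1 j) & s = join j i p t].
Proof.
rewrite mem_Motzkin_avoiding; set n := (i + j).+2 => /andP[perm_s av_s] idx.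
have uniq_s : uniq s by rewrite (perm_uniq perm_s) iota_uniq.
have n_s : n \in s by rewrite (perm_mem perm_s) mem_iota; lia.
case/and3P: av_s => av132 nvinc _.
have [A [B [def_s size_A]]] : exists A B, s = A ++ n :: B /\ size A = i.+1.
  have lt_is : i.+1 < size s by rewrite -idx index_mem.
  exists (take i.+1 s), (drop i.+2 s); split; last by rewrite size_takel // ltnW.
  rewrite -[LHS](cat_take_drop i.+1) (drop_nth 0) //.
  by rewrite -idx nth_index // idx.
subst s; clear idx n_s.
have lt_n x : x \in A ++ B -> x < n.
  move=> xAB; have : x \in A ++ n :: B.
    by move: xAB; rewrite !mem_cat inE orbCA => ->; rewrite orbT.
  have : n \notin A ++ B.
    by move: uniq_s; rewrite -[n :: B]cat1s uniq_catCA => /andP[].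
  rewrite (perm_mem perm_s) mem_iota => /memPn/(_ x xAB); lia.
(* If [a < b], then [a], [n], [b] would form a 132. *)
have gtAB a b : a \in A -> b \in B -> b < a.
  move=> aA bB; have /avoids132P/(_ a n b) := av132.
  have -> : subseq [:: a; n; b] (A ++ n :: B).
    by rewrite (@cat_subseq _ [:: a]) ?sub1seq //= eqxx sub1seq.
  have ltbn : b < n by rewrite lt_n // mem_cat bB orbT.
  have neq_ab : a != b.
    move: uniq_s; rewrite cat_uniq => /and3P[_ /hasPn/(_ b) + _].
    by rewrite inE bB orbT => /(_ isT)/memPn/(_ a aA).
  by move=> /(_ isT); lia.
clear av132; elim/last_ind: A => [//|p m _] in size_A gtAB lt_n perm_s nvinc uniq_s *.
move: size_A; rewrite size_rcons => -[size_p].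
have ltmn : m < n by rewrite lt_n // mem_cat mem_rcons mem_head.
(* Since [m] and [n] are adjacent, an earlier [a < m] would violate the vincular condition. *)
have gtpm a : a \in p -> m < a.
  move=> ap; have /vincularP/(_ (index a p) (size p)) := nvinc.
  rewrite index_mem ap size_cat size_rcons addSn !nth_cat size_rcons.
  rewrite !ltnS index_size leqnn ltnn subnn !nth_rcons index_mem ap ltnn eqxx.
  have /memPn/(_ a ap) : m \notin p.
    by move: uniq_s; rewrite cat_uniq rcons_uniq => /andP[/andP[]].
  rewrite nth_index // -[nth 0 (n :: B) 0]/n -[size (n :: B)]/(size B).+1.
  by move=> neq_am /(_ isT); lia.
have size_B : size B = j.
  by have := perm_size perm_s; rewrite size_cat size_rcons /= size_iota; lia.
(* Three cuts peel off the values from below: first [B], then [m], then [p], leaving [n]. For the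
   last two [n] is moved to the front, which is harmless up to permutation. *)
have [a b||] := @perm_iota_cut 1 n (rcons p m ++ [:: n]) B.
- rewrite mem_cat inE => /orP[/gtAB|/eqP->]; first exact.
  by move=> bB; rewrite lt_n // mem_cat bB orbT.
- by rewrite -catA.
rewrite size_B => perm_B; rewrite size_cat size_rcons addn1 size_p => perm_pmn.
have [a b||] := @perm_iota_cut (1 + j) i.+2 (n :: p) [:: m].
- by rewrite !inE => /predU1P[->|/gtpm ltma] /eqP->.
- by apply: perm_trans perm_pmn; rewrite !cats1 /= perm_sym perm_rcons.
move=> /perm_mem/(_ m); rewrite mem_head inE => /esym/eqP def_m perm_np.
have [a b||] := @perm_iota_cut (1 + j + 1) i.+1 [:: n] p.
- by rewrite inE => /eqP-> bp; rewrite lt_n // mem_cat mem_rcons inE bp orbT.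
- by rewrite cat1s -[i]size_p.
rewrite size_p => perm_p _.
(* Truncated subtraction undoes the shift, because every letter of [p] exceeds [m], which equals
   [j.+1]. *)
exists (map (subn^~ j.+1) p), B; split=> //.
  have -> : iota 1 i = map (subn^~ j.+1) (iota (1 + j + 1) i).
    rewrite iotaDl -map_comp map_id_in // => a _; exact: addKn.
  exact: perm_map.
rewrite /join -map_comp map_id_in => [|a /gtpm ltma] /=; last by lia.
by rewrite def_m add1n -cats1 -!catA.
Qed.

(** The map [join j i] is injective because the length [i] of [p] fixes the cut points, and
    [Motzkin_avoiding_split] gives surjectivity. *)
Lemma size_Motzkin_max_later i j :
  size [seq s <- Motzkin_avoiding tau (i + j).+2 | index (i + j).+2 s == i.+1] =
  size (Motzkin_avoiding rho i) * size (Motzkin_avoiding tau j).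
Proof.
rewrite -(size_allpairs (join j i)); apply/perm_size/uniq_perm.
- by rewrite filter_uniq ?uniq_Motzkin_avoiding.
- apply: allpairs_uniq; try exact: uniq_Motzkin_avoiding.
  move=> _ _ /allpairsP[[p s] [/= pP _ ->]] /allpairsP[[q t] [/= qP _ ->]] /eqP.
  move: pP qP; rewrite !mem_Motzkin_avoiding => /andP[/perm_size + _].
  move=> size_p /andP[/perm_size]; rewrite -size_p => size_q _.
  rewrite /= /join !eqseq_cat ?size_cat ?size_map ?size_q // eqxx andbT.
  case/andP=> /eqP/inj_map-> => [|x y /addnI //]; by move/eqP->.
move=> s; rewrite mem_filter; apply/andP/allpairsP => [[/eqP idx s_in]|].
  have [p [t [perm_p perm_t def_s]]] := Motzkin_avoiding_split i j s s_in idx.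
  exists (p, t); move: s_in.
  rewrite !mem_Motzkin_avoiding /= def_s motzkin_avoids_join //.
  by rewrite perm_p perm_t => /and3P[].
case=> -[p t] /= []; rewrite !mem_Motzkin_avoiding.
move=> /andP[perm_p av_p] /andP[perm_t av_t] ->.
rewrite perm_join // motzkin_avoids_join // av_p av_t; split=> //.
rewrite /join -catA index_cat size_map (perm_size perm_p) size_iota.
case: ifP => [/mapP[x]|_].
  by rewrite (perm_mem perm_p) mem_iota => /andP[_ ltx]; lia.
have ltj : j.+1 < (i + j).+2 by lia.
by rewrite /= eqxx (ltn_eqF ltj) addn1.
Qed.

Lemma size_Motzkin_avoiding_rec n :
  size (Motzkin_avoiding tau n.+1) =
  size (Motzkin_avoiding tau n) +
  \sum_(i < n) size (Motzkin_avoiding rho i) *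
               size (Motzkin_avoiding tau (n.-1 - i)).
Proof.
rewrite (@size_partition _ (index n.+1) n.+1) => [|s].
  rewrite big_ord_recl /= size_Motzkin_max_first; congr (_ + _).
  apply: eq_bigr => i _; rewrite -size_Motzkin_max_later /bump /= add1n.
  (* With the maximum at position [i.+1], there are [i] letters before [m] and [n.-1 - i] after the
     maximum. *)
  by have -> : (i + (n.-1 - i)).+1 = n by have := ltn_ord i; lia.
rewrite mem_Motzkin_avoiding => /andP[perm_s _].
rewrite -[X in _ < X](size_iota 1) -(perm_size perm_s) index_mem.
by rewrite (perm_mem perm_s) mem_iota; lia.
Qed.

End Recurrence.

(** * From the recurrence to the generating function *)

Lemma fcoefXM (R : comNzRingType) (f : fps R) n :
  fcoef (fpsX R * f)%R n = if n is m.+1 then fcoef f m else 0%R.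
Proof.
rewrite fcoefM; case: n => [|n]; first by rewrite big_ord1 GRing.mul0r.
rewrite !big_ord_recl big1 => [|i _]; last by rewrite GRing.mul0r.
by rewrite GRing.mul0r GRing.add0r GRing.mul1r GRing.addr0 subn1.
Qed.

Theorem theorem3p6 (k : nat) (rho' tau rho : seq nat) :
  4 <= k ->
  tau = rho' ++ [:: 1; k] ->
  tau \in Motzkin k ->
  rho = [seq i.-1 | i <- rho'] ->
  rho \in Motzkin (k - 2) ->
  let x := fpsX int in
  (N tau = 1 / (1 - x - x ^+ 2 * N rho))%R.
Proof.
move=> gt3k def_tau tauP def_rho rhoP x.
have perm_tau : perm_eq tau (iota 1 k).
  by move: tauP; rewrite mem_filter mem_permutations => /andP[].
have perm_rho : perm_eq rho (iota 1 (k - 2)).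
  by move: rhoP; rewrite mem_filter mem_permutations => /andP[].
have rho_lt : all (fun i => 0 < i < k.-1) rho.
  by apply/allP=> i; rewrite (perm_mem perm_rho) mem_iota; lia.
have rho_gt0 : 0 < size rho by rewrite (perm_size perm_rho) size_iota; lia.
(* Taking predecessors loses nothing, since the letters of [rho'] are letters of [tau] and hence
   positive. *)
have {}def_tau : tau = map S rho ++ [:: 1; k].
  rewrite def_tau def_rho -map_comp map_id_in // => i i_rho /=.
  have : i \in tau by rewrite def_tau mem_cat i_rho.
  by rewrite (perm_mem perm_tau) mem_iota; lia.
have rec n := @size_Motzkin_avoiding_rec k rho (ltac:(lia)) rho_lt rho_gt0 n.
(* The recurrence read coefficientwise; [x ^+ 2] is split into two factors, each of which shifts the
   coefficients by one. *)
have def_N : (N tau = 1 + x * N tau + x * (x * (N rho * N tau)))%R.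
  apply/fpsP => n; rewrite !fcoefD !fcoefXM fcoef1.
  case: n => [|n].
    rewrite /= size_Motzkin_avoiding0 //.
    by rewrite def_tau size_cat addn2.
  rewrite /N [LHS]/= def_tau rec -def_tau PoszD GRing.add0r; congr (_ + _)%R.
  rewrite fcoefXM.
  case: n => [|n]; first by rewrite big_ord0.
  by rewrite fcoefM /= (big_morph Posz PoszD (erefl _)).
(* As the denominator is invertible, it suffices that its product with [N tau] is 1. *)
apply: (canRL (GRing.mulrK (denominator_unit rho))).
have expand (R : comNzRingType) (a b c : R) :
  (a * (1 - c - c ^+ 2 * b) = a - (c * a + c * (c * (b * a))))%R by ring.
rewrite expand; apply: (canLR (GRing.addrK _)).
by rewrite GRing.addrA -def_N.
Qed.
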